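(* Let $G$ be a finite group with $N_g$ elements and let $\Gamma_c^p(g)\in\mathbb{C}^{d_p\times d_p}$ ($g\in G$) be complex unitary matrices of an irreducible representation of $G$ which is potentially real. Let $A^p\in\mathbb{C}^{d_p\times d_p}$ be a nonsingular matrix with $(A^p)^T=A^p$ such that the matrix $Z^p$ defined in step 1 is nonzero. Then the following steps compute a unitary matrix $S^p\in\mathbb{C}^{d_p\times d_p}$ that is a similarity transformation between the given complex unitary irreducible representation and a real orthonormal one, i.e. $S^p$ is unitary and $(S^p)^H\Gamma_c^p(g)S^p$ is a real orthogonal matrix for every $g\in G$: 1. Compute $Z^p=\frac{1}{N_g}\sum_{g\in G}\Gamma_c^p(g)\,A^p\,\big((\Gamma_c^p(g))^\ast\big)^{-1}$. 2. Compute the positive real number $c_Z$ determined by $(Z^p)^\ast Z^p=c_Z I_{d_p}$, and set $C^p=Z^p/\sqrt{c_Z}$. 3. Compute the eigenvalues and (orthonormal) eigenvectors of the real symmetric matrix $B^p=\begin{bmatrix}\Re C^p & \Im C^p\\ \Im C^p & -\Re C^p\end{bmatrix}\in\mathbb{R}^{2d_p\times 2d_p}$. 4. Form the matrix $V^p\in\mathbb{R}^{2d_p\times d_p}$ whose columns are the $d_p$ (orthonormal) eigenvectors of $B^p$ that have positive eigenvalues. 5. Set $S^p=[I_{d_p},\ iI_{d_p}]\,V^p$.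
   Context: For a matrix $M$: $M^\ast$ is the entrywise complex conjugate, $M^T$ the transpose, $M^H=(M^\ast)^T$ the Hermitian transpose; $\Re$ and $\Im$ are entrywise real and imaginary parts; $I_n$ is the $n\times n$ identity. A unitary irreducible representation $\Gamma_c^p$ of $G$ is potentially real if there exists a unitary matrix $S$ such that $S^H\Gamma_c^p(g)S$ is real for all $g\in G$. *)

(* Defs.v *)
From HB Require Import structures.
From mathcomp Require Import all_boot all_order all_algebra all_fingroup.
From mathcomp Require Import mxrepresentation spectral complex reals.

Set Implicit Arguments.
Unset Strict Implicit.
Unset Printing Implicit Defensive.

Import Order.TTheory GRing.Theory Num.Theory.
Local Open Scope ring_scope.
Local Open Scope sesquilinear_scope.
Local Open Scope complex_scope.

Section Notions.
Variable R : realType.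
Local Notation C := R[i].

(* The notation M ^t* of spectral.v is the Hermitian transpose, and
   realmx is the predicate "all entries are real" on complex matrices. *)

Definition potentially_real (gT : finGroupType) (G : {group gT}) (d : nat)
    (rG : mx_representation C G d) : Prop :=
  exists2 S : 'M[C]_d, S \is unitarymx &
    {in G, forall g, S ^t* *m rG g *m S \is a realmx}.

Definition real_orthogonal (d : nat) (M : 'M[C]_d) : Prop :=
  M \is a realmx /\ M^T *m M = 1%:M.

Definition averaged_mx (gT : finGroupType) (G : {group gT}) (d : nat)
    (rG : mx_representation C G d) (A : 'M[C]_d) : 'M[C]_d :=
  #|G|%:R^-1 *: \sum_(g in G) rG g *m A *m invmx (map_mx Num.conj (rG g)).

Definition normalized_mx (d : nat) (Z : 'M[C]_d) (c : R) : 'M[C]_d :=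
  ((Num.sqrt c)%:C)^-1 *: Z.

Definition real_block_mx (d : nat) (M : 'M[C]_d) : 'M[R]_(d + d) :=
  let ReM := map_mx (@complex.Re R) M in
  let ImM := map_mx (@complex.Im R) M in
  block_mx ReM ImM ImM (- ReM).

(* The j-th column of Q is a (column) eigenvector of B for the eigenvalue
   lam 0 j; eigenvalues are repeated according to their multiplicity. *)
Definition orthonormal_eigenbasis (n : nat) (B Q : 'M[R]_n) (lam : 'rV[R]_n)
    : Prop :=
  Q^T *m Q = 1%:M /\ forall j, B *m col j Q = lam 0 j *: col j Q.

(* The columns of V are, in an arbitrary order and without repetition, exactly
   the columns of Q whose eigenvalue is positive. In particular, the existence
   of such a V with d columns says that exactly d of the lam 0 j are positive. *)
Definition positive_eigenvectors (n d : nat) (Q : 'M[R]_n) (lam : 'rV[R]_n)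
    (V : 'M[R]_(n, d)) : Prop :=
  exists f : 'I_d -> 'I_n,
    [/\ injective f, forall j, (j \in codom f) = (0 < lam 0 j)
      & V = colsub f Q].

Definition complexified_mx (d : nat) (V : 'M[R]_(d + d, d)) : 'M[C]_d :=
  row_mx 1%:M ('i%C)%:M *m map_mx (real_complex R) V.

End Notions.

(* Main.v *)
Require Import Defs.
From HB Require Import structures.
From mathcomp Require Import all_boot all_order all_algebra all_fingroup.
From mathcomp Require Import mxrepresentation spectral complex reals.

Set Implicit Arguments.
Unset Strict Implicit.
Unset Printing Implicit Defensive.

Import Order.TTheory GRing.Theory Num.Theory.
Local Open Scope ring_scope.
Local Open Scope sesquilinear_scope.
Local Open Scope complex_scope.

(** Write conj X for the entrywise conjugate of X and X^H for its Hermitian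
    transpose.

    Averaging turns A into an intertwiner between the representation and its
    conjugate: rG g *m Z = Z *m conj (rG g). It also keeps the symmetry of A,
    because for a unitary matrix the inverse of the conjugate is the transpose.
    If X and Y are two such intertwiners, X *m conj Y commutes with the
    representation, so it is scalar by Schur's lemma
    ([conj_intertwiner_pair_scalar]). For X = Y = Z symmetric, this product is
    Z *m Z^H, whose diagonal entries are sums of squared moduli; so the scalar
    is a positive real c, and M = Z / sqrt c is symmetric, intertwining and
    satisfies conj M *m M = 1.

    The real block matrix B of M is the real form of the antilinear map
    S |-> M *m conj S: stacking real parts over imaginary parts ([realify])
    turns that map into multiplication by B ([real_block_mx_realify]). The map
    is an involution, so B has eigenvalues 1 and -1 only, and its trace is 0 by
    its block shape; hence exactly half of any orthonormal eigenbasis has a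
    positive eigenvalue, and the selected columns V are fixed by B. In complex
    terms, S = [I, iI] V satisfies M *m conj S = S.

    Such an S does the job ([conj_fixed_gram_real]). As M is symmetric, the
    fixed point equation also reads S^H = S^T *m conj M, so for every D with
    D *m M = M *m conj D the matrix S^H *m D *m S equals its own conjugate.
    With D = 1, S^H *m S is real; its real part is V^T *m V = 1, so S is
    unitary. With D = rG g, S^H *m rG g *m S is real, and being unitary it is
    real orthogonal.

    An orthonormal eigenbasis of B is exhibited directly. A unitary S0 that
    makes the representation real gives another symmetric intertwiner
    S0 *m S0^T, which by Schur's lemma differs from M by a phase; absorbing a
    square root of the phase into S0 yields a unitary S with M = S *m S^T
    ([coninvolutory_intertwiner_takagi]). The real forms of the columns of S
    and of i S are then eigenvectors for 1 and -1 ([takagi_eigenbasis]). *)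

Local Notation cj := (map_mx Num.conj).

(** * Intertwiners between a representation and its conjugate *)

Section Conjugation.
Variable C : numClosedFieldType.

Lemma conjmxK m n (M : 'M[C]_(m, n)) : cj (cj M) = M.
Proof. by apply/matrixP => i j; rewrite !mxE conjCK. Qed.

Lemma realmxP m n (M : 'M[C]_(m, n)) : reflect (cj M = M) (M \is a realmx).
Proof.
apply: (iffP idP) => [/realmxC //|eqM].
by apply/mxOverP => i j; apply/CrealP; rewrite -[in RHS]eqM mxE.
Qed.

Lemma unitarymx_mulCt n (U : 'M[C]_n) : U \is unitarymx -> U ^t* *m U = 1%:M.
Proof. by move/unitarymxP/mulmx1C. Qed.

Lemma unitarymx_mulT n (U : 'M[C]_n) : U \is unitarymx -> U^T *m cj U = 1%:M.
Proof.
by move=> /unitarymx_mulCt /(congr1 cj); rewrite map_mxM conjmxK map_mx1.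
Qed.

Lemma unitarymx_mulC n (U : 'M[C]_n) : U \is unitarymx -> cj U *m U^T = 1%:M.
Proof. by move/unitarymx_mulT/mulmx1C. Qed.

(** Over a closed field X has an eigenvalue a; then X - a is singular and
    commutes with the representation, so Schur's lemma makes it zero. *)
Lemma schur_centralizer_scalar (gT : finGroupType) (G : {group gT}) n
    (rG : mx_representation C G n) (X : 'M[C]_n) :
    mx_irreducible rG -> {in G, forall g, X *m rG g = rG g *m X} ->
  exists a : C, X = a%:M.
Proof.
move=> irrG cXG; have [n_gt0 _] := (mx_irrP rG).1 irrG.
have [a /negP evXa] := eigenvalue_closed X n_gt0; exists a.
apply/eqP; rewrite -subr_eq0; apply: contra_notT evXa => nzXa.
rewrite /eigenspace kermx_eq0 row_free_unit.
apply: (mx_Schur irrG) nzXa; apply/centgmxP => g Gg.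
by rewrite mulmxBl mulmxBr cXG // scalar_mxC.
Qed.

Definition conj_intertwiner (gT : finGroupType) (G : {group gT}) n
    (rG : mx_representation C G n) (X : 'M[C]_n) :=
  {in G, forall g, rG g *m X = X *m cj (rG g)}.

(** Y intertwines rG with its conjugate, so conj Y intertwines in the opposite
    direction and the composite X *m conj Y is in the centralizer of rG. *)
Lemma conj_intertwiner_pair_scalar (gT : finGroupType) (G : {group gT}) n
    (rG : mx_representation C G n) (X Y : 'M[C]_n) :
    mx_irreducible rG -> conj_intertwiner rG X -> conj_intertwiner rG Y ->
  exists a : C, X *m cj Y = a%:M.
Proof.
move=> irrG iX iY; apply: (schur_centralizer_scalar irrG) => g Gg.
have := congr1 cj (iY g Gg); rewrite !map_mxM conjmxK => eqY.
by rewrite -mulmxA -eqY !mulmxA iX.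
Qed.

(** For a symmetric Z, conj Z is the Hermitian transpose of Z, so the diagonal
    entry of Z *m conj Z at a nonzero row of Z is the squared norm of the row. *)
Lemma sym_conj_scalar_gt0 n (Z : 'M[C]_n) (a : C) :
  Z^T = Z -> Z != 0 -> Z *m cj Z = a%:M -> 0 < a.
Proof.
move=> symZ nzZ eqZ.
have [[i j] nzij] : exists p : 'I_n * 'I_n, Z p.1 p.2 != 0.
  apply/existsP; apply: contraNT nzZ => /existsPn Z0; apply/eqP/matrixP => i j.
  by have := Z0 (i, j); rewrite mxE negbK => /eqP.
have -> : a = \sum_k `|Z i k| ^+ 2.
  have := congr1 (fun X : 'M_n => X i i) eqZ; rewrite !mxE eqxx mulr1n => <-.
  by apply: eq_bigr => k _; rewrite mxE normCK -[in Z k i]symZ mxE.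
rewrite (bigD1 j) //= ltr_wpDr ?exprn_gt0 ?normr_gt0 //.
by apply: sumr_ge0 => k _; rewrite exprn_ge0.
Qed.

Lemma unit_phase_sqrt (a : C) :
  `|a| = 1 -> exists w : C, `|w| = 1 /\ w ^+ 2 * a = 1.
Proof.
move=> a1; exists (sqrtC a^-1); rewrite sqrtCK mulVf; last first.
  by rewrite -normr_gt0 a1.
split=> //; apply/eqP; rewrite -(@eqrXn2 _ 2) // -normrX sqrtCK normfV a1 invr1.
by rewrite expr1n.
Qed.

(** Applying the conjugate transpose to the fixed point equation of S gives
    S^H = S^T *m conj M. Substituting this on the left and T = M *m conj T on
    the right, D is conjugated when it moves past M, and conj M *m M
    cancels. *)
Lemma conj_fixed_gram_real n p q (M D : 'M[C]_n)
    (S : 'M[C]_(n, p)) (T : 'M[C]_(n, q)) :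
    M^T = M -> cj M *m M = 1%:M -> M *m cj S = S -> M *m cj T = T ->
    D *m M = M *m cj D ->
  S ^t* *m D *m T \is a realmx.
Proof.
move=> symM M1 fixS fixT DM; apply/realmxP; symmetry.
have fixSt : S ^t* = S^T *m cj M.
  by rewrite -{1}fixS trmx_mul map_mxM symM map_trmx conjmxK.
rewrite !map_mxM conjmxK -{1}fixT fixSt.
rewrite !mulmxA -[_ *m D *m M]mulmxA DM !mulmxA.
by rewrite -[_ *m cj M *m M]mulmxA M1 mulmx1.
Qed.

End Conjugation.

(** * The averaged matrix *)

Section Averaging.
Variables (R : realType) (gT : finGroupType) (G : {group gT}) (d : nat).
Variable rG : mx_representation R[i] G d.
Hypothesis rG_unitary : {in G, forall g, rG g \is unitarymx}.

(** In this form the average is visibly a congruence average, which keeps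
    symmetric matrices symmetric. *)
Lemma averaged_mxE (A : 'M[R[i]]_d) :
  averaged_mx rG A = #|G|%:R^-1 *: \sum_(g in G) rG g *m A *m (rG g)^T.
Proof.
congr (_ *: _); apply: eq_bigr => g Gg; congr (_ *m _).
by rewrite invmx_unitary ?conjC_unitary ?rG_unitary // map_trmx conjmxK.
Qed.

Lemma averaged_mx_sym (A : 'M[R[i]]_d) :
  A^T = A -> (averaged_mx rG A)^T = averaged_mx rG A.
Proof.
move=> symA; rewrite averaged_mxE linearZ /= raddf_sum; congr (_ *: _).
by apply: eq_bigr => g Gg /=; rewrite !trmx_mul trmxK symA mulmxA.
Qed.

Lemma averaged_mx_intertwiner (A : 'M[R[i]]_d) :
  conj_intertwiner rG (averaged_mx rG A).
Proof.
move=> h Gh; rewrite averaged_mxE -scalemxAr -scalemxAl; congr (_ *: _).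
rewrite mulmx_sumr mulmx_suml.
rewrite [RHS](reindex_inj (mulgI h)) /=; apply: eq_big => [g|g Gg].
  by rewrite groupMl.
rewrite repr_mxM // trmx_mul !mulmxA -[_ *m (rG h)^T *m _]mulmxA.
by rewrite unitarymx_mulT ?rG_unitary // mulmx1.
Qed.

(** Equating S^H *m rG g *m S with its conjugate and multiplying by S on the
    left and S^T on the right cancels the two outer unitary factors. *)
Lemma potentially_real_intertwiner (S : 'M[R[i]]_d) :
    S \is unitarymx -> {in G, forall g, S ^t* *m rG g *m S \is a realmx} ->
  conj_intertwiner rG (S *m S^T).
Proof.
move=> unitS realS g Gg; have /realmxP := realS g Gg.
rewrite !map_mxM conjmxK => eqSg; have SSt := unitarymxP unitS.
rewrite -[rG g]mul1mx -{1}SSt -!mulmxA [rG g *m _]mulmxA [S ^t* *m _]mulmxA.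
rewrite [S ^t* *m (rG g *m S)]mulmxA -eqSg -!mulmxA unitarymx_mulC // mulmx1.
by rewrite !mulmxA mul1mx.
Qed.

End Averaging.

(** * Real forms of complex matrices *)

Section RealForm.
Variable R : realType.
Local Notation Remx := (map_mx (@complex.Re R)).
Local Notation Immx := (map_mx (@complex.Im R)).
Local Notation toC := (map_mx (real_complex R)).

Definition realify m n (S : 'M[R[i]]_(m, n)) : 'M[R]_(m + m, n) :=
  col_mx (Remx S) (Immx S).

Lemma ReD (x y : R[i]) : complex.Re (x + y) = complex.Re x + complex.Re y.
Proof. by case: x y => [? ?] [? ?]. Qed.

Lemma ImD (x y : R[i]) : complex.Im (x + y) = complex.Im x + complex.Im y.
Proof. by case: x y => [? ?] [? ?]. Qed.

Lemma Remx_mul m n p (M : 'M[R[i]]_(m, n)) (N : 'M_(n, p)) :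
  Remx (M *m N) = Remx M *m Remx N - Immx M *m Immx N.
Proof.
apply/matrixP => i j; rewrite !mxE (big_morph _ ReD (erefl _)) -sumrB.
by apply: eq_bigr => k _; rewrite !mxE; case: (M i k) (N k j) => [? ?] [? ?].
Qed.

Lemma Immx_mul m n p (M : 'M[R[i]]_(m, n)) (N : 'M_(n, p)) :
  Immx (M *m N) = Remx M *m Immx N + Immx M *m Remx N.
Proof.
apply/matrixP => i j; rewrite !mxE (big_morph _ ImD (erefl _)) -big_split.
by apply: eq_bigr => k _; rewrite !mxE; case: (M i k) (N k j) => [? ?] [? ?].
Qed.

Lemma Remx_conj m n (M : 'M[R[i]]_(m, n)) : Remx (cj M) = Remx M.
Proof. by apply/matrixP => i j; rewrite !mxE; case: (M i j). Qed.

Lemma Immx_conj m n (M : 'M[R[i]]_(m, n)) : Immx (cj M) = - Immx M.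
Proof. by apply/matrixP => i j; rewrite !mxE; case: (M i j). Qed.

Lemma realify_inj m n : injective (@realify m n).
Proof.
move=> S T /eq_col_mx[eqRe eqIm]; apply/matrixP => i j; apply/eqP.
move/matrixP/(_ i j): eqRe; move/matrixP/(_ i j): eqIm; rewrite !mxE => eI eR.
by rewrite eq_complex eI eR !eqxx.
Qed.

Lemma realify_complexified d (V : 'M[R]_(d + d, d)) :
  realify (complexified_mx V) = V.
Proof.
rewrite -[V in RHS]vsubmxK /complexified_mx -[V in LHS]vsubmxK map_col_mx.
rewrite mul_row_col mul1mx mul_scalar_mx; congr col_mx.
  by apply/matrixP => i j; rewrite !mxE /= !mul0r !mul1r subrr addr0.
by apply/matrixP => i j; rewrite !mxE /= mul0r mul1r !add0r.
Qed.

Lemma conj_mxZi m n (S : 'M[R[i]]_(m, n)) :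
  cj ('i%C *: S) = - ('i%C *: cj S).
Proof.
rewrite -scaleNr map_mxZ; congr (_ *: _).
by apply/eqP; rewrite eq_complex /= oppr0 !eqxx.
Qed.

Lemma realifyN m n (S : 'M[R[i]]_(m, n)) : realify (- S) = - realify S.
Proof.
rewrite /realify opp_col_mx.
by congr col_mx; apply/matrixP => i j; rewrite !mxE; case: (S i j).
Qed.

(** The Euclidean inner product of real forms is the real part of the Hermitian
    one; this transfers orthonormality in one direction, and transfers it back
    once the Hermitian product is known to be real. *)
Lemma realify_gram m n p (S : 'M[R[i]]_(m, n)) (T : 'M[R[i]]_(m, p)) :
  (realify S)^T *m realify T = Remx (S ^t* *m T).
Proof.
rewrite /realify tr_col_mx mul_row_col Remx_mul Remx_conj Immx_conj.
by rewrite mulNmx opprK !map_trmx.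
Qed.

(** The block matrix of M is the real form of the antilinear map
    S |-> M *m conj S. *)
Lemma real_block_mx_realify d n (M : 'M[R[i]]_d) (S : 'M[R[i]]_(d, n)) :
  real_block_mx M *m realify S = realify (M *m cj S).
Proof.
rewrite /real_block_mx /realify mul_block_col Remx_mul Immx_mul.
rewrite !Remx_conj !Immx_conj !mulmxN mulNmx opprK; congr col_mx.
by rewrite addrC.
Qed.

Lemma real_block_mx_tr d (M : 'M[R[i]]_d) :
  M^T = M -> (real_block_mx M)^T = real_block_mx M.
Proof.
by move=> symM; rewrite /real_block_mx tr_block_mx linearN /= !map_trmx symM.
Qed.

Lemma real_block_mx_trace d (M : 'M[R[i]]_d) : \tr (real_block_mx M) = 0.
Proof. by rewrite mxtrace_block linearN subrr. Qed.

(** The square of S |-> M *m conj S is multiplication by M *m conj M. *)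
Lemma real_block_mx_involution d (M : 'M[R[i]]_d) :
  M *m cj M = 1%:M -> real_block_mx M *m real_block_mx M = 1%:M.
Proof.
move=> MM; have BB (V : 'M[R]_(d + d, d)) :
    real_block_mx M *m (real_block_mx M *m V) = V.
  rewrite -[V]realify_complexified !real_block_mx_realify map_mxM conjmxK.
  by rewrite mulmxA MM mul1mx.
(* A real form with d columns covers half of the identity of size d + d. *)
rewrite -[LHS]mulmx1 -[in LHS](hsubmxK 1%:M) -[RHS]hsubmxK -mulmxA !mul_mx_row.
by rewrite !BB.
Qed.

Lemma complexified_fixed d (M : 'M[R[i]]_d) (V : 'M[R]_(d + d, d)) :
    real_block_mx M *m V = V ->
  M *m cj (complexified_mx V) = complexified_mx V.
Proof.
move=> BV; apply: realify_inj.
by rewrite -real_block_mx_realify realify_complexified.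
Qed.

(** Orthonormality of V only controls the real part of S^H *m S; the imaginary
    part vanishes because S is fixed by the antilinear map of M. *)
Lemma fixed_orthonormal_unitary d (M : 'M[R[i]]_d) (V : 'M[R]_(d + d, d)) :
    M^T = M -> cj M *m M = 1%:M ->
    V^T *m V = 1%:M -> real_block_mx M *m V = V ->
  complexified_mx V \is unitarymx.
Proof.
move=> symM MM VV /complexified_fixed; set S := complexified_mx V => fixS.
apply/unitarymxP/mulmx1C.
have realSS : S ^t* *m S \is a realmx.
  rewrite -[S ^t*]mulmx1; apply: (conj_fixed_gram_real symM) => //.
  by rewrite map_mx1 mul1mx mulmx1.
have ReSS : Remx (S ^t* *m S) = 1%:M.
  by rewrite -realify_gram realify_complexified.
apply/matrixP => i j; rewrite -(RRe_real (mxOverP realSS i j)).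
by move/matrixP/(_ i j): ReSS; rewrite !mxE => ->; rewrite rmorph_nat.
Qed.

Lemma mulmx_col m n p (A : 'M[R]_(m, n)) (B : 'M_(n, p)) j :
  A *m col j B = col j (A *m B).
Proof. by rewrite !colE mulmxA. Qed.

(** M *m conj S = S because S^T *m conj S = 1, and i S is sent to its opposite
    by antilinearity; the two real forms are orthogonal since i S^H *m S is
    purely imaginary. *)
Lemma takagi_eigenbasis d (M S : 'M[R[i]]_d) :
    S \is unitarymx -> M = S *m S^T ->
  orthonormal_eigenbasis (real_block_mx M)
    (row_mx (realify S) (realify ('i%C *: S)))
    (row_mx (const_mx 1) (const_mx (-1))).
Proof.
move=> unitS ->; have SS := unitarymx_mulCt unitS.
have fixS : S *m S^T *m cj S = S.
  by rewrite -mulmxA unitarymx_mulT // mulmx1.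
split; last first.
  have BS1 : real_block_mx (S *m S^T) *m realify S = realify S.
    by rewrite real_block_mx_realify fixS.
  have BS2 : real_block_mx (S *m S^T) *m realify ('i%C *: S)
             = - realify ('i%C *: S).
    rewrite real_block_mx_realify conj_mxZi mulmxN -scalemxAr fixS.
    exact: realifyN.
  move=> j; rewrite -[j]splitK; case: (split j) => k /=.
    by rewrite row_mxEl mxE scale1r colKl mulmx_col BS1.
  by rewrite row_mxEr mxE scaleN1r colKr mulmx_col BS2 linearN.
have iSt : ('i%C *: S) ^t* = - 'i%C *: S ^t*.
  by rewrite linearZ /= conj_mxZi scaleNr.
rewrite tr_row_mx mul_col_row !realify_gram iSt.
rewrite -!scalemxAl -!scalemxAr SS.
rewrite [in RHS]scalar_mx_block.
congr block_mx; apply/matrixP => i j; rewrite !mxE; case: (i == j) => /=.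
all: by rewrite ?(oppr0, mul0r, mulr0, mulr1, mulN1r, sub0r, opprK, add0r).
Qed.

(** * Orthonormal eigenbases of a real involution *)

Lemma orthonormal_eigenbasis_mx n (B Q : 'M[R]_n) (lam : 'rV[R]_n) :
  orthonormal_eigenbasis B Q lam -> B *m Q = Q *m diag_mx lam.
Proof.
case=> _ BQ; apply/matrixP => i j; rewrite mul_mx_diag mxE.
by move/colP/(_ i): (BQ j); rewrite mulmx_col !mxE mulrC.
Qed.

Lemma involution_eigenvalues n (B Q : 'M[R]_n) (lam : 'rV[R]_n) :
    B *m B = 1%:M -> orthonormal_eigenbasis B Q lam ->
  forall j, lam 0 j = if 0 < lam 0 j then 1 else -1.
Proof.
move=> BB basisQ j; have BQ := orthonormal_eigenbasis_mx basisQ.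
have [QQ _] := basisQ.
have DD : diag_mx lam *m diag_mx lam = 1%:M.
  rewrite -[LHS]mul1mx -QQ -!mulmxA [Q *m _]mulmxA -BQ -mulmxA -BQ.
  by rewrite [B *m _]mulmxA BB mul1mx.
have /eqP : lam 0 j ^+ 2 = 1.
  by move/matrixP/(_ j j): DD; rewrite mulmx_diag !mxE eqxx mulr1n.
by rewrite sqrf_eq1 => /orP[] /eqP ->; rewrite ?ltr01 // oppr_gt0 ltr10.
Qed.

(** The eigenvalues are 1 and -1 and add up to the trace, so both signs occur
    equally often. *)
Lemma card_positive_eigenvalues d (B Q : 'M[R]_(d + d)) (lam : 'rV[R]_(d + d)) :
    B *m B = 1%:M -> \tr B = 0 -> orthonormal_eigenbasis B Q lam ->
  #|[set j | 0 < lam 0 j]| = d.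
Proof.
move=> BB trB basisQ; have BQ := orthonormal_eigenbasis_mx basisQ.
have [QQ _] := basisQ; have sgn_lam := involution_eigenvalues BB basisQ.
set P := [set j | _].
have trD : \tr B = \sum_j lam 0 j.
  rewrite -mxtrace_diag -[B]mulmx1 -(mulmx1C QQ) mulmxA BQ mxtrace_mulC.
  by rewrite mulmxA QQ mul1mx.
have eqPN : #|P|%:R = #|~: P|%:R :> R.
  apply/eqP; rewrite -subr_eq0 -trB trD (bigID (mem P)) /=.
  rewrite (eq_bigr (fun=> 1)); last first.
    by move=> j; rewrite inE => posj; rewrite sgn_lam posj.
  rewrite [X in _ == _ + X](eq_bigr (fun=> -1)); last first.
    by move=> j; rewrite inE => /negbTE nposj; rewrite sgn_lam nposj.
  rewrite sumrN !sumr_const -cardsE.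
  rewrite (_ : #|[pred j | j \notin P]| = #|~: P|) //.
  by apply: eq_card => j; rewrite !inE.
move/eqP: eqPN; rewrite eqr_nat => /eqP eqPN.
have := cardsC P; rewrite -eqPN card_ord.
by move: #|P| => k; rewrite !addnn => /double_inj.
Qed.

Lemma positive_eigenvectors_exist n d (Q : 'M[R]_n) (lam : 'rV[R]_n) :
    #|[set j | 0 < lam 0 j]| = d ->
  exists V : 'M_(n, d), positive_eigenvectors Q lam V.
Proof.
move=> cardP; case: d / cardP; exists (colsub enum_val Q), enum_val; split=> //.
  exact: enum_val_inj.
move=> j; apply/codomP/idP => [[k ->]|lamj].
  by have := enum_valP k; rewrite inE.
have Pj : j \in [set j | 0 < lam 0 j] by rewrite inE.
by exists (enum_rank_in Pj j); rewrite enum_rankK_in.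
Qed.

Lemma positive_eigenvectors_fixed n d (B Q : 'M[R]_n) (lam : 'rV[R]_n)
    (V : 'M[R]_(n, d)) :
    B *m B = 1%:M -> orthonormal_eigenbasis B Q lam ->
    positive_eigenvectors Q lam V ->
  V^T *m V = 1%:M /\ B *m V = V.
Proof.
move=> BB basisQ [f [inj_f posf ->]].
have [QQ eigQ] := basisQ; have sgn_lam := involution_eigenvalues BB basisQ.
split.
  apply/matrixP => i j; move/matrixP/(_ (f i) (f j)): QQ.
  rewrite !mxE (inj_eq inj_f) => <-.
  by apply: eq_bigr => k _; rewrite !mxE.
apply/matrixP => i j; have := eigQ (f j).
rewrite sgn_lam -posf codom_f scale1r mulmx_col => /colP/(_ i).
rewrite !mxE => <-.
by apply: eq_bigr => k _; rewrite !mxE.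
Qed.

End RealForm.

(** * Scaling constants and phases *)

Lemma scalar_mx_inj_pos (K : nzRingType) n :
  (0 < n)%N -> injective (@scalar_mx K n).
Proof.
case: n => // n _ a b /matrixP/(_ 0 0).
by rewrite !mxE !eqxx !mulr1n.
Qed.

(** Both S0 *m S0^T and M are intertwiners, so Schur's lemma gives
    S0 *m S0^T = a M; a is a phase since all the factors are unitary, and
    multiplying S0 by a square root of its inverse removes it. The result is a
    Takagi factorization of M. *)
Lemma coninvolutory_intertwiner_takagi (R : realType) (gT : finGroupType)
    (G : {group gT}) (d : nat) (rG : mx_representation R[i] G d)
    (M : 'M[R[i]]_d) :
    mx_irreducible rG -> potentially_real rG -> conj_intertwiner rG M ->
    M^T = M -> cj M *m M = 1%:M ->
  exists2 S : 'M[R[i]]_d, S \is unitarymx & M = S *m S^T.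
Proof.
move=> irrG [S0 unitS0 realS0] iM symM MM.
have iS0 := potentially_real_intertwiner unitS0 realS0.
have [a eqa] := conj_intertwiner_pair_scalar irrG iS0 iM.
have S0M : S0 *m S0^T = a *: M.
  by rewrite -mul_scalar_mx -eqa -mulmxA MM mulmx1.
have [d_gt0 _] := (mx_irrP rG).1 irrG.
have a1 : `|a| = 1.
  have unitM : cj M \is unitarymx.
    by apply/unitarymxP; rewrite map_trmx conjmxK symM.
  have : a%:M \is @unitarymx _ d d.
    by rewrite -eqa !mul_unitarymx // trmx_unitary.
  move/unitarymxP; rewrite tr_scalar_mx map_scalar_mx -scalar_mxM.
  move/(scalar_mx_inj_pos d_gt0) => aa.
  by apply/eqP; rewrite -(@eqrXn2 _ 2) // normCK aa expr1n.
have [w [w1 wa]] := unit_phase_sqrt a1.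
exists (w *: S0); last first.
  by rewrite linearZ /= -scalemxAl -scalemxAr scalerA S0M scalerA wa scale1r.
apply/unitarymxP; rewrite linearZ /= map_mxZ -scalemxAl -scalemxAr scalerA.
by rewrite (unitarymxP unitS0) -normCK w1 expr1n scale1r.
Qed.

(** * Construction of the real form of the representation *)

Lemma normalized_mx_coninvolutory (R : realType) d (Z : 'M[R[i]]_d) (c : R) :
    0 < c -> cj Z *m Z = (c%:C)%:M ->
  cj (normalized_mx Z c) *m normalized_mx Z c = 1%:M.
Proof.
move=> c_gt0 ZZ; rewrite /normalized_mx -fmorphV; set s := (Num.sqrt c)^-1.
have conj_s : Num.conj s%:C = s%:C by apply/CrealP; rewrite complex_real.
rewrite map_mxZ -scalemxAl -scalemxAr ZZ scalerA /= conj_s.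
rewrite scale_scalar_mx -!rmorphM /=.
rewrite -[c in _ * c]sqr_sqrtr ?ltW // -expr2 -exprMn mulVf ?expr1n //.
by rewrite gt_eqF ?sqrtr_gt0.
Qed.

(** The scalar given by Schur's lemma is positive, hence real, so it does not
    matter on which side of Z its conjugate stands. *)
Lemma conj_gram_determined (R : realType) (gT : finGroupType) (G : {group gT})
    (d : nat) (rG : mx_representation R[i] G d) (Z : 'M[R[i]]_d) :
    mx_irreducible rG -> conj_intertwiner rG Z -> Z^T = Z -> Z != 0 ->
  exists! c : R, 0 < c /\ cj Z *m Z = (c%:C)%:M.
Proof.
move=> irrG iZ symZ nzZ; have [d_gt0 _] := (mx_irrP rG).1 irrG.
have [a eqa] := conj_intertwiner_pair_scalar irrG iZ iZ.
have a_gt0 := sym_conj_scalar_gt0 symZ nzZ eqa.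
have [c def_a] : exists c : R, a = c%:C by apply/complex_realP/gtr0_real.
rewrite def_a ltcR in a_gt0; exists c; split=> [|c' [_ eqc']].
  split=> //; have := congr1 cj eqa.
  rewrite map_mxM conjmxK map_scalar_mx def_a => ->.
  by congr (_%:M); exact: conjc_real.
have := congr1 cj eqc'; rewrite map_mxM conjmxK eqa map_scalar_mx def_a.
by move/(scalar_mx_inj_pos d_gt0) => -[].
Qed.

Theorem theorem5p5 (R : realType) (gT : finGroupType) (G : {group gT})
    (d : nat) (rG : mx_representation R[i] G d)
    (rG_unitary : {in G, forall g, rG g \is unitarymx})
    (rG_irr : mx_irreducible rG)
    (rG_real : potentially_real rG)
    (A : 'M[R[i]]_d) (A_unit : A \in unitmx) (A_sym : A^T = A)
    (Z_neq0 : averaged_mx rG A != 0) :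
  let Z := averaged_mx rG A in
  let determines_c (c : R) := 0 < c /\ map_mx Num.conj Z *m Z = (c%:C)%:M in
  (exists! c : R, determines_c c) /\
  forall c : R, determines_c c ->
  let B := real_block_mx (normalized_mx Z c) in
  [/\ B^T = B,
      exists Q : 'M[R]_(d + d), exists lam : 'rV[R]_(d + d),
        orthonormal_eigenbasis B Q lam
    & forall (Q : 'M[R]_(d + d)) (lam : 'rV[R]_(d + d)),
      orthonormal_eigenbasis B Q lam ->
      (exists V : 'M[R]_(d + d, d), positive_eigenvectors Q lam V) /\
      forall V : 'M[R]_(d + d, d), positive_eigenvectors Q lam V ->
      let S := complexified_mx V in
      S \is unitarymx /\
      {in G, forall g, real_orthogonal (S ^t* *m rG g *m S)}].
Proof.
move=> Z determines_c.
have symZ : Z^T = Z by exact: averaged_mx_sym.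
have iZ : conj_intertwiner rG Z by exact: averaged_mx_intertwiner.
split=> [|c [c_gt0 ZZ] B]; first exact: conj_gram_determined iZ symZ Z_neq0.
pose M := normalized_mx Z c.
have MM : cj M *m M = 1%:M by exact: normalized_mx_coninvolutory.
have symM : M^T = M by rewrite linearZ /= symZ.
have iM : conj_intertwiner rG M.
  by move=> g Gg; rewrite -scalemxAr iZ // scalemxAl.
have BB : B *m B = 1%:M by apply: real_block_mx_involution; exact: mulmx1C.
split; first exact: real_block_mx_tr.
  have [S unitS eqM] :=
    coninvolutory_intertwiner_takagi rG_irr rG_real iM symM MM.
  by eexists; eexists; exact: takagi_eigenbasis unitS eqM.
move=> Q lam basisQ; split.
  apply: positive_eigenvectors_exist.
  exact: card_positive_eigenvalues BB (real_block_mx_trace _) basisQ.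
move=> V /(positive_eigenvectors_fixed BB basisQ)[VV BV] S.
have fixS : M *m cj S = S by exact: complexified_fixed.
have unitS : S \is unitarymx by exact: fixed_orthonormal_unitary symM MM VV BV.
split=> // g Gg.
have realSg : S ^t* *m rG g *m S \is a realmx.
  by apply: (conj_fixed_gram_real symM) => //; exact: iM.
split=> //; rewrite -{1}(realmxP _ realSg) map_trmx.
apply: unitarymx_mulCt.
by apply: mul_unitarymx => //; apply: mul_unitarymx;
  [rewrite trmxC_unitary | exact: rG_unitary].
Qed.
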